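(* For $\alpha\in\,]0,1[$ define $$f(\alpha):=\limsup_{n\to\infty}\log_n\bigl(e_{\lfloor n^{\alpha}\rfloor}(n)\bigr).$$ Then: (i) if $\alpha\in\,]0,1/2]$, then $f(\alpha)=\max\{1-\alpha,\,2\alpha\}$; (ii) if $\alpha\in[1-2^{-k},\,1-2^{-(k+1)}]$ for some integer $k\geqslant 1$, then $f(\alpha)\geqslant \max\left\{\frac{1-\alpha}{2^{-k}},\,\frac{\alpha}{1-2^{-(k+1)}}\right\}$; (iii) $\min_{\alpha\in\,]0,1[} f(\alpha)=2/3$.
   Context: For $n\geqslant 1$, $Q_n$ denotes the $n$-dimensional hypercube: its vertices are all binary sequences $x=(x_i)_{i=1,\dots,n}$, and it is equipped with the Hamming distance $\rho(x,y)=|\{i : x_i\neq y_i\}|$. For a positive integer $d$, a non-empty subset $S\subseteq Q_n$ is called $d$-equilateral if $\rho(x,y)=d$ for all distinct $x,y\in S$. $e_d(n)$ denotes the maximal cardinality of a $d$-equilateral subset of $Q_n$. $\log_n$ denotes the logarithm to base $n$. *)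

(* Defs.v *)
From mathcomp Require Export all_boot all_order all_algebra.
From mathcomp Require Export reals ereal exp sequences.

Set Implicit Arguments.
Unset Strict Implicit.
Unset Printing Implicit Defensive.

Definition hypercube (n : nat) : finType := {ffun 'I_n -> bool}.

Definition hamming (n : nat) (x y : hypercube n) : nat :=
  #|[pred i : 'I_n | x i != y i]|.

Definition equilateral (n d : nat) (S : {set hypercube n}) : bool :=
  (S != set0) &&
  [forall x in S, forall y in S, (x != y) ==> (hamming x y == d)].

(* A singleton is always [d]-equilateral, so this is a genuine maximum. *)
Definition e_max (d n : nat) : nat :=
  \max_(S : {set hypercube n} | equilateral d S) #|S|.

Local Open Scope ring_scope.

Definition logb (R : realType) (b x : R) : R := ln x / ln b.

(* The limit superior is taken in the extended reals, so that no boundedness of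
   the sequence is presupposed; its junk terms [n = 0, 1], where [logb n%:R] is
   not a logarithm, do not affect it. *)
Definition equilateral_exponent (R : realType) (a : R) : \bar R :=
  limn_esup (fun n : nat =>
    (logb n%:R (e_max (Num.truncn (n%:R `^ a)) n)%:R)%:E).

(* Main.v *)
Require Import Defs.
From mathcomp Require Import zify ring lra finfield.
Import Order.TTheory GRing.Theory Num.Theory.
Local Open Scope ring_scope.

(** Upper bound: with weights summing to zero, an equilateral set of size [N]
    satisfies [2 \sum_i (\sum_x c_x x_i)^2 = d \sum_x c_x^2], which forces each
    coordinate to take one of its two values at most [d] times.  Flip coordinates
    so that the majority value is [0]: all words get weight at most [2 d] and each
    meets at most [2 d^2] words, so if [N > 4 d^2 + 2] any two words are disjoint
    from a common third one.  All weights then equal [d / 2], the words are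
    disjoint (a sunflower), and [d N <= 2 n].

    Lower bound: start from [p] disjoint blocks of size [r] and iterate [k] times
    the concatenation with the outer code of affine lines over a field having as
    many elements as there are codewords.  With [K = 2 ^ k] this gives [p ^ K]
    codewords at mutual distance [d = 2 r p ^ (K - 1)] in length at most [d p].
    The two lower bounds come from the choices
    [r ~ p ^ (a / (1 - a) - (K - 1))] and [r = 1]. *)

Set Implicit Arguments.
Unset Strict Implicit.
Unset Printing Implicit Defensive.

(** * Upper bound for equilateral sets *)

(** Coordinate [i] contributes [x_i (1 - y_i) + (1 - x_i) y_i] to the distance. Since the weights
    sum to zero, the words with a [0] at [i] have total weight opposite to those with a [1], whence
    a negative square. *)
Lemma sum_hamming (n : nat) (c : hypercube n -> int) :
  \sum_x c x = 0 ->
  \sum_x \sum_y c x * c y * (hamming x y)%:R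
    = - 2 * \sum_i (\sum_(x : hypercube n | x i) c x) ^+ 2.
Proof.
move=> c0.
have hamE (x y : hypercube n) : (hamming x y)%:R =
    \sum_i ((x i)%:R * (~~ y i)%:R + (~~ x i)%:R * (y i)%:R) :> int.
  rewrite /hamming -sum1_card natr_sum big_mkcond /=; apply: eq_bigr => i _.
  by rewrite inE; case: (x i); case: (y i); rewrite /= ?mulr0 ?mul0r ?mulr1 ?addr0 ?add0r.
transitivity (\sum_i \sum_(x : hypercube n) \sum_(y : hypercube n)
    (c x * (x i)%:R * (c y * (~~ y i)%:R) + c x * (~~ x i)%:R * (c y * (y i)%:R))).
  under eq_bigr => x _ do under eq_bigr => y _ do rewrite hamE mulr_sumr.
  under eq_bigr => x _ do rewrite exchange_big /=.
  rewrite exchange_big /=; apply: eq_bigr => i _.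
  by apply: eq_bigr => x _; apply: eq_bigr => y _; ring.
rewrite mulr_sumr; apply: eq_bigr => i _.
have s1 : \sum_(x : hypercube n) c x * (x i)%:R = \sum_(x : hypercube n | x i) c x.
  by rewrite [RHS]big_mkcond; apply: eq_bigr => x _; case: (x i); rewrite ?mulr1 ?mulr0.
have s0 : \sum_(x : hypercube n) c x * (~~ x i)%:R = - \sum_(x : hypercube n | x i) c x.
  apply/eqP; rewrite -addr_eq0 -s1 -big_split /= -[eqbRHS]c0; apply/eqP.
  by apply: eq_bigr => x _; case: (x i); rewrite /= ?mulr1 ?mulr0 ?addr0 ?add0r.
under eq_bigr => x _ do rewrite big_split /= -!mulr_sumr s0 s1.
by rewrite big_split /= -!mulr_suml s0 s1; ring.
Qed.

Lemma equilateralP (n d : nat) (S : {set hypercube n}) :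
  reflect (S != set0 /\ {in S &, forall x y, x != y -> hamming x y = d})
          (equilateral d S).
Proof.
apply: (iffP andP) => -[S0 H]; split=> //.
  move=> x y xS yS xy; move/forall_inP/(_ x xS)/forall_inP/(_ y yS): H.
  by rewrite xy => /eqP.
apply/forall_inP => x xS; apply/forall_inP => y yS; apply/implyP => xy.
by rewrite (H x y).
Qed.

Lemma hammingxx n (x : hypercube n) : hamming x x = 0%N.
Proof. by apply: eq_card0 => i; rewrite inE eqxx. Qed.

(** On [S] the distance matrix is [d (J - I)] with [J] the all-ones matrix; zero-sum weights kill
    [J], and only the diagonal remains. *)
Lemma equilateral_sum_sqr n d (S : {set hypercube n}) (c : hypercube n -> int) :
  equilateral d S -> {in [predC S], forall x, c x = 0} -> \sum_x c x = 0 ->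
  2 * \sum_i (\sum_(x : hypercube n | x i) c x) ^+ 2
    = d%:R * \sum_(x in S) c x ^+ 2.
Proof.
case/equilateralP=> _ eqS cS c0.
have := sum_hamming c0; rewrite mulNr => /eqP; rewrite -eqr_oppLR => /eqP <-.
rewrite mulr_sumr -sumrN [RHS]big_mkcond /=; apply: eq_bigr => x _.
have [xS|xS] := boolP (x \in S); last first.
  by rewrite big1 ?oppr0 // => y _; rewrite cS ?mul0r.
transitivity (- \sum_y (c x * d%:R * c y - (if y == x then c x * d%:R * c y else 0))).
  congr (- _); apply: eq_bigr => y _.
  have [->|yx] := eqVneq y x; first by rewrite hammingxx mulr0 subrr.
  have [yS|yS] := boolP (y \in S); last by rewrite (cS y yS) !mulr0 mul0r subrr.
  by rewrite eqS 1?eq_sym// subr0; ring.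
by rewrite sumrB -mulr_sumr c0 mulr0 -big_mkcond big_pred1_eq; ring.
Qed.

(* Weighting the [p] words with a one by [q] and the [q] words with a zero by
   [- p], the coordinate [i] alone contributes [2 (p q)^2 <= d p q (p + q)]. *)
Lemma equilateral_minority n d (S : {set hypercube n}) (i : 'I_n) :
  equilateral d S ->
  (minn #|[set x in S | x i]| #|[set x in S | ~~ x i]| <= d)%N.
Proof.
move=> eqS; set P := [set x in S | x i]; set Q := [set x in S | ~~ x i].
pose c (x : hypercube n) : int :=
  #|Q|%:R * (x \in P)%:R - #|P|%:R * (x \in Q)%:R.
have sumI (A : {set hypercube n}) : \sum_x (x \in A)%:R = #|A|%:R :> int.
  rewrite -sum1_card natr_sum [RHS]big_mkcond /=.
  by apply: eq_bigr => x _; case: (x \in A).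
have c0 : \sum_x c x = 0 by rewrite sumrB -!mulr_sumr !sumI; ring.
have cS : {in [predC S], forall x, c x = 0}.
  by move=> x; rewrite !inE /c !inE => /negbTE->; rewrite /= !mulr0 subrr.
have := equilateral_sum_sqr eqS cS c0.
have -> : \sum_(x in S) c x ^+ 2 = #|P|%:R * #|Q|%:R * (#|P|%:R + #|Q|%:R).
  transitivity (\sum_x (#|Q|%:R ^+ 2 * (x \in P)%:R + #|P|%:R ^+ 2 * (x \in Q)%:R : int)).
    rewrite big_mkcond; apply: eq_bigr => x _; rewrite /c !inE.
    by case: (x \in S); case: (x i); rewrite /=; ring.
  by rewrite big_split /= -!mulr_sumr !sumI; ring.
have ci : \sum_(x : hypercube n | x i) c x = #|P|%:R * #|Q|%:R.
  transitivity (\sum_x (#|Q|%:R * (x \in P)%:R : int)).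
    rewrite big_mkcond; apply: eq_bigr => x _; rewrite /c !inE.
    by case: (x \in S); case: (x i); rewrite /=; ring.
  by rewrite -mulr_sumr sumI; ring.
rewrite (bigD1 i) //= ci => eq1.
have: 2 * (#|P|%:R * #|Q|%:R) ^+ 2
    <= d%:R * (#|P|%:R * #|Q|%:R * (#|P|%:R + #|Q|%:R)) :> int.
  by rewrite -eq1 ler_pM2l// lerDl sumr_ge0// => j _; rewrite sqr_ge0.
move: #|P| #|Q| => p q; clear.
rewrite -!(natrM, natrD, natrX) ler_nat => H.
have [p0|p0] := posnP p; first by rewrite p0 min0n.
have [q0|q0] := posnP q; first by rewrite q0 minn0.
have {}H : (2 * (p * q) <= d * (p + q))%N.
  rewrite -(@leq_pmul2r (p * q)) ?muln_gt0 ?p0//; move: H; congr (_ <= _)%N; lia.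
(* If [d < p] and [d < q], then [d p + d q < 2 p q], against [H]. *)
rewrite leqNgt; apply/negP; rewrite leq_min => /andP[dp dq].
nia.
Qed.

(* Distances are preserved when every coordinate is flipped so that its majority
   value in [S] becomes [0]; [minority S x] is the support of the flipped [x]. *)
Definition minority n (S : {set hypercube n}) (x : hypercube n) : {set 'I_n} :=
  [set i | x i != (#|[set y in S | ~~ y i]| <= #|[set y in S | y i]|)%N].

Lemma hamming_minority n (S : {set hypercube n}) (x y : hypercube n) :
  (hamming x y + 2 * #|minority S x :&: minority S y|
    = #|minority S x| + #|minority S y|)%N.
Proof.
have cardE (A : {pred 'I_n}) : #|A| = (\sum_i (i \in A))%N.
  by rewrite -sum1_card [LHS]big_mkcond; apply: eq_bigr => i _; case: (i \in A).
rewrite /hamming !cardE big_distrr -!big_split /=.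
apply: eq_bigr => i _; rewrite !inE.
by case: leq; case: (x i); case: (y i).
Qed.

Lemma card_minority_col n d (S : {set hypercube n}) (i : 'I_n) :
  equilateral d S -> (#|[set x in S | i \in minority S x]| <= d)%N.
Proof.
move=> eqS; apply: leq_trans (equilateral_minority i eqS).
rewrite leq_min; have [le|lt] := leqP #|[set y in S | ~~ y i]| #|[set y in S | y i]|.
  have -> : [set x in S | i \in minority S x] = [set y in S | ~~ y i].
    by apply/setP => x; rewrite !inE le; case: (x i).
  by rewrite le leqnn.
have -> : [set x in S | i \in minority S x] = [set y in S | y i].
  by apply/setP => x; rewrite !inE leqNgt lt; case: (x i).
by rewrite leqnn ltnW.
Qed.

(** Count the pairs [(y, i)] with [x i != y i] in two ways. At a coordinate where [x] has the
    minority value, at most [d] words agree with [x], so at least [#|S| - d] differ from it. *)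
Lemma card_minority_row n d (S : {set hypercube n}) (x : hypercube n) :
  equilateral d S -> x \in S ->
  (#|minority S x| * (#|S| - d) <= d * #|S|.-1)%N.
Proof.
move=> eqS xS; have /equilateralP[_ eqS'] := eqS.
have <- : (\sum_(y in S) hamming x y = d * #|S|.-1)%N.
  rewrite (bigD1 x) //= hammingxx add0n.
  transitivity (\sum_(y in S :\ x) d)%N.
    apply: eq_big => y; first by rewrite !inE andbC.
    by case/andP => yS yx; rewrite eqS' // eq_sym.
  by rewrite sum_nat_const (cardsD1 x S) xS mulnC.
have -> : (\sum_(y in S) hamming x y = \sum_i #|[set y in S | x i != y i]|)%N.
  transitivity (\sum_(y in S) \sum_(i | x i != y i) 1)%N.
    by apply: eq_bigr => y _; rewrite sum1_card.
  rewrite (exchange_big_dep predT) //=; apply: eq_bigr => i _.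
  by rewrite -sum1_card; apply: eq_bigl => y; rewrite !inE.
rewrite -sum_nat_const [leqRHS](bigID (mem (minority S x))) /=.
apply: leq_trans (leq_addr _ _); apply: leq_sum => i ix.
have := card_minority_col i eqS; rewrite leq_subLR => le_d.
apply: (@leq_trans (#|[set y in S | i \in minority S y]| + #|[set y in S | x i != y i]|)).
  apply: leq_trans (leq_card_setU _ _).1; apply: subset_leq_card.
  apply/subsetP => y yS; rewrite !inE yS /=; move: ix; rewrite inE.
  by case: leq; case: (x i); case: (y i).
by rewrite leq_add2r.
Qed.

Lemma equilateral_card n d (S : {set hypercube n}) :
  equilateral d S -> (#|S| <= 4 * d ^ 2 + 2)%N || (d * #|S| <= 2 * n)%N.
Proof.
move=> eqS; have [//|big] := leqP; rewrite /=.
have /equilateralP[_ eqS'] := eqS.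
have row x : x \in S -> (#|minority S x| <= 2 * d)%N.
  move=> xS; have := card_minority_row eqS xS; nia.
pose meets x := [set y in S | ~~ [disjoint minority S x & minority S y]].
have card_meets x : x \in S -> (#|meets x| <= 2 * d ^ 2)%N.
  move=> xS; apply: (@leq_trans (\sum_(i in minority S x) d)%N); last first.
    by rewrite sum_nat_const; have := row x xS; nia.
  apply: (@leq_trans
    (\sum_(i in minority S x) #|[set y in S | i \in minority S y]|)%N); last first.
    by apply: leq_sum => i _; exact: card_minority_col.
  have -> : meets x = \bigcup_(i in minority S x) [set y in S | i \in minority S y].
    apply/setP => y; rewrite inE; apply/andP/bigcupP => [[yS /pred0Pn[i /andP[ix iy]]]|].
      by exists i => //; rewrite inE yS.
    move=> [i ix]; rewrite inE => /andP[yS iy]; split=> //.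
    by apply/pred0Pn; exists i; apply/andP.
  elim/big_rec2: _ => [|i A m _ le]; first by rewrite cards0.
  by apply: leq_trans (leq_card_setU _ _).1 _; rewrite leq_add2l.
pose wt x := #|minority S x|.
have wtD x y : x \in S -> y \in S -> x != y ->
    (d + 2 * #|minority S x :&: minority S y| = wt x + wt y)%N.
  by move=> xS yS xy; rewrite -(eqS' x y) // hamming_minority.
have wtD0 x y : x \in S -> y \in S -> x != y ->
    [disjoint minority S x & minority S y] -> (d = wt x + wt y)%N.
  move=> xS yS xy; rewrite -setI_eq0 => /eqP dxy.
  by rewrite -(wtD x y) // dxy cards0 muln0 addn0.
(* The words [x], [y] and those meeting one of them number at most [2 + 2 * (2 d^2)], which is the
   threshold in [big]; some [z] thus avoids both, and [wt x + wt z = d = wt y + wt z]. *)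
have weight x y : x \in S -> y \in S -> wt x = wt y.
  move=> xS yS.
  have [z zS] : exists2 z, z \in S & z \notin [set x; y] :|: (meets x :|: meets y).
    apply/subsetPn; apply: contraTN big => /subset_leq_card le.
    rewrite -leqNgt (leq_trans le) // (leq_trans (leq_card_setU _ _).1) //.
    have := (leq_card_setU (meets x) (meets y)).1.
    have := card_meets x xS; have := card_meets y yS; have := cards2 x y.
    by case: (x != y) => /= ->; lia.
  rewrite !inE zS /= !negb_or !negbK => /andP[/andP[zx zy] /andP[dx dy]].
  rewrite eq_sym in zx; rewrite eq_sym in zy.
  have := wtD0 x z xS zS zx dx; have := wtD0 y z yS zS zy dy; lia.
have [x xS] : exists x, x \in S by apply/card_gt0P; lia.
have [z zS] : exists2 z, z \in S & z \notin [set x] :|: meets x.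
  apply/subsetPn; apply: contraTN big => /subset_leq_card le.
  rewrite -leqNgt (leq_trans le) // (leq_trans (leq_card_setU _ _).1) //.
  by rewrite cards1; have := card_meets x xS; lia.
rewrite !inE zS /= negb_or negbK => /andP[zx dxz].
rewrite eq_sym in zx.
have w2 : (2 * wt x = d)%N.
  by rewrite [RHS](wtD0 x z) // (weight z x) // mul2n addnn.
have disj : {in S &, forall y y', y != y' -> [disjoint minority S y & minority S y']}.
  move=> y y' yS y'S yy'; rewrite -setI_eq0 -cards_eq0.
  have := wtD y y' yS y'S yy'; rewrite (weight y x) // (weight y' x) // => eq1.
  by apply/eqP; lia.
(* The supports are disjoint, so each of the [n] coordinates is counted at most once. *)
have : (\sum_(y in S) wt y <= n)%N.
  under eq_bigr => y _ do rewrite /wt -sum1_card.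
  rewrite (exchange_big_dep predT) //= -[leqRHS]card_ord -sum1_card.
  apply: leq_sum => i _; rewrite sum1_card; apply/card_le1_eqP => y y'.
  rewrite -!topredE /= => /andP[yS iy] /andP[y'S iy']; apply: contraTeq isT => yy'.
  by have := disjointFr (disj y' y y'S yS yy') iy'; rewrite iy.
rewrite (eq_bigr (fun=> wt x)) ?sum_nat_const => [|y yS]; last exact: weight.
by move=> le_n; rewrite -w2 -mulnA leq_mul2l /= mulnC.
Qed.

(** * Equidistant codes *)

(** Codewords and positions range over arbitrary finite types, so that products of codes need no
    renumbering. *)
Definition equidistant {T P : finType} (d : nat) (w : T -> P -> bool) : Prop :=
  forall x y, x != y -> #|[pred i | w x i != w y i]| = d.

(** Positions are embedded into ['I_n] and the remaining coordinates padded with [false]. As [d] is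
    positive, distinct indices give distinct words. *)
Lemma equidistant_e_max (T P : finType) (d n : nat) (w : T -> P -> bool) :
  (0 < d)%N -> (0 < #|T|)%N -> (#|P| <= n)%N -> equidistant d w ->
  (#|T| <= e_max d n)%N.
Proof.
move=> d0 T0 Pn wd.
pose h (i : P) : 'I_n := widen_ord Pn (enum_rank i).
have h_inj : injective h by move=> i j /(congr1 val) /= /val_inj /enum_rank_inj.
pose e (x : T) : hypercube n := [ffun j => [exists i, (h i == j) && w x i]].
have eh x i : e x (h i) = w x i.
  rewrite ffunE; apply/existsP/idP => [[j /andP[/eqP/h_inj->]]//|wxi].
  by exists i; rewrite eqxx.
have e_out x j : j \notin codom h -> e x j = false.
  move=> jh; rewrite ffunE; apply/existsP => -[i /andP[/eqP hij _]].
  by rewrite -hij codom_f in jh.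
have hamE x y : x != y -> hamming (e x) (e y) = d.
  move=> /wd <-; rewrite /hamming -(card_image h_inj); apply: eq_card => j.
  rewrite inE; apply/idP/imageP => [exy|[i + ->]]; last by rewrite inE !eh.
  have /codomP[i ji] : j \in codom h by apply: contraNT exy => jh; rewrite !e_out.
  by exists i => //; rewrite inE -!eh -ji.
have e_inj : injective e.
  move=> x y exy; apply/eqP; apply: contraTT d0 => /hamE <-.
  by rewrite exy -leqNgt leqn0; apply/eqP/eq_card0 => i; rewrite inE eqxx.
rewrite -(card_codom e_inj) -cardsE /e_max.
apply: (leq_bigmax_cond (F := fun S : {set hypercube n} => #|S|)).
apply/andP; split.
  by rewrite -card_gt0 cardsE card_codom.
apply/forall_inP => _ /[!inE]/codomP[x ->].
apply/forall_inP => _ /[!inE]/codomP[y ->].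
by apply/implyP => exy; rewrite hamE//; apply: contraNneq exy => ->.
Qed.

(* The outer code [(a, b) |-> (x |-> a x + b, oo |-> a)] has exactly one
   agreement between any two distinct codewords. *)
Lemma equidistant_product (F : finFieldType) (T P : finType) (d : nat)
    (w : T -> P -> bool) :
  #|T| = #|F| -> equidistant d w ->
  exists w' : F * F -> option F * P -> bool, equidistant (#|F| * d) w'.
Proof.
move=> TF wd.
pose g (a : F) : T := enum_val (cast_ord (esym TF) (enum_rank a)).
have g_inj : injective g by move=> a b /enum_val_inj/cast_ord_inj/enum_rank_inj.
pose c (u : F * F) (o : option F) := if o is Some x then u.1 * x + u.2 else u.1.
exists (fun u z => w (g (c u z.1)) z.2) => u v uv.
(* Parallel lines agree only at infinity, other lines only at the abscissa of their intersection. *)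
have agree : exists o, forall o', (c u o' == c v o') = (o' == o).
  have [a_eq|a_neq] := eqVneq u.1 v.1.
    exists None => -[x|] /=; last by rewrite a_eq !eqxx.
    rewrite a_eq (inj_eq (addrI _)); apply: contraNF uv => /eqP b_eq.
    by rewrite [u]surjective_pairing [v]surjective_pairing a_eq b_eq.
  have a0 : u.1 - v.1 != 0 by rewrite subr_eq0.
  exists (Some ((v.2 - u.2) / (u.1 - v.1))) => -[x|] /=; last first.
    by apply/negbTE.
  rewrite (inj_eq (@Some_inj _)); apply/eqP/eqP => [e|->]; last by field.
  apply: (mulIf a0); rewrite divfK//; apply/eqP; rewrite -subr_eq0; apply/eqP.
  transitivity (u.1 * x + u.2 - (v.1 * x + v.2)); first by ring.
  by rewrite e subrr.
have {agree}[o agree] := agree.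
(* Of the [#|F| + 1] outer positions, all but [o] carry distinct inner codewords, each contributing
   [d]. *)
transitivity (\sum_(o' : option F | o' != o) d)%N; last first.
  rewrite sum_nat_const; congr (_ * _)%N.
  transitivity #|predC1 o|; last by rewrite cardC1 card_option.
  by apply: eq_card => o'; rewrite !inE.
rewrite -sum1_card.
transitivity (\sum_o' \sum_(i | w (g (c u o')) i != w (g (c v o')) i) 1)%N.
  by rewrite pair_big_dep; apply: eq_bigl => -[].
rewrite [RHS]big_mkcond /=; apply: eq_bigr => o' _.
rewrite sum1_card; case: ifPn => oo'.
  by apply: wd; rewrite (inj_eq g_inj) agree.
move: oo'; rewrite negbK -agree => /eqP ->.
by apply: eq_card0 => i; rewrite -topredE /= eqxx.
Qed.

(** With [N] codewords, one step squares [N], multiplies the distance by [N] and the length by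
    [N + 1]. The length is therefore [r p] times a product that telescopes after multiplication by
    [p - 1]. Primality of [p] supplies a field of size [N] at each level. *)
Lemma equidistant_tower (p r k : nat) : prime p ->
  exists (T P : finType) (w : T -> P -> bool),
   [/\ #|T| = (p ^ 2 ^ k)%N,
       (#|P| * p.-1 = r * p * (p ^ 2 ^ k).-1)%N &
       equidistant (2 * r * p ^ (2 ^ k).-1) w].
Proof.
move=> pp; have p0 := prime_gt0 pp.
elim: k => [|k [T [P [w [Tc Pc wd]]]]].
  (* Codeword [x] is the indicator of the block [x]; two disjoint blocks of size [r] are at distance
     [2 r]. *)
  exists 'I_p, ('I_p * 'I_r)%type, (fun x z => z.1 == x).
  rewrite card_prod !card_ord /= !expn1 muln1; split=> [//||x y xy].
    by rewrite (mulnC p).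
  transitivity #|setX [set x; y] [set: 'I_r]|.
    apply: eq_card => -[z i]; rewrite !inE /= andbT.
    have [->|zx] /= := eqVneq z x; first by rewrite xy.
    by case: (z == y).
  by rewrite cardsX cards2 xy cardsT card_ord.
have [F _ Fc] := pPrimePowerField pp (expn_gt0 2 k).
have [w' w'd] := equidistant_product (etrans Tc (esym Fc)) wd.
exists (F * F)%type, (option F * P)%type, w'.
have K0 : (0 < 2 ^ k)%N by rewrite expn_gt0.
have N0 : (0 < p ^ 2 ^ k)%N by rewrite expn_gt0 p0.
rewrite !card_prod card_option Fc expnS mul2n -addnn expnD; split=> //.
  rewrite -mulnA Pc; move: (p ^ 2 ^ k)%N N0 => N N0; nia.
move: w'd; rewrite Fc; congr equidistant.
by rewrite mulnCA -expnD; congr (_ * p ^ _)%N; lia.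
Qed.

(** The tower has length at most [r p^(2^k) p / (p - 1)], and [p <= 2 (p - 1)] bounds this by
    [2 r p^(2^k) = d p]. *)
Lemma e_max_ge (p r k n : nat) (d := (2 * r * p ^ (2 ^ k).-1)%N) :
  prime p -> (0 < r)%N -> (d * p <= n)%N -> (p ^ 2 ^ k <= e_max d n)%N.
Proof.
move=> pp r0 dn; have p1 := prime_gt1 pp; have p0 := ltnW p1.
have K0 : (0 < 2 ^ k)%N by rewrite expn_gt0.
have [T [P [w [Tc Pc wd]]]] := equidistant_tower r k pp.
rewrite -Tc; apply: (equidistant_e_max _ _ _ wd).
- by rewrite !muln_gt0 r0 expn_gt0 p0.
- by rewrite Tc expn_gt0 p0.
apply: leq_trans dn.
have -> : (d * p = 2 * r * p ^ 2 ^ k)%N by rewrite /d -mulnA -expnSr prednK.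
rewrite -(@leq_pmul2r p.-1) ?Pc; last lia.
have N0 : (0 < p ^ 2 ^ k)%N by rewrite expn_gt0 p0.
apply: (@leq_trans (r * p * p ^ 2 ^ k)); first by rewrite leq_mul2l leq_pred orbT.
rewrite [leqRHS]mulnAC leq_mul2r; apply/orP; right; nia.
Qed.

(** * Growth exponents *)

From mathcomp Require Import classical_sets normedtype.

Lemma limn_esup_le (R : realType) (u : nat -> R) (v : R) :
  (forall e, 0 < e -> exists N, forall n, (N <= n)%N -> u n <= v + e) ->
  (limn_esup (fun n => (u n)%:E) <= v%:E)%E.
Proof.
move=> H; apply/lee_addgt0Pr => e /H[N HN]; rewrite /limn_esup limf_esupE.
apply: (@le_trans _ _ (ereal_sup [set (u n)%:E | n in [set n | (N <= n)%N]]%classic)).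
  by apply: ereal_inf_lbound; exists [set n | (N <= n)%N]%classic => //; exists N.
by apply: ge_ereal_sup => _ [n /= Nn <-]; rewrite -EFinD lee_fin HN.
Qed.

Lemma le_limn_esup (R : realType) (u : nat -> R) (v : R) :
  (forall e, 0 < e -> forall N, exists2 n, (N <= n)%N & v <= u n + e) ->
  (v%:E <= limn_esup (fun n => (u n)%:E))%E.
Proof.
move=> H; rewrite /limn_esup limf_esupE; apply: le_ereal_inf_tmp => _ [V [N _ NV] <-].
apply/lee_addgt0Pr => e /H/(_ N)[n Nn vu].
apply: (@le_trans _ _ ((u n)%:E + e%:E)%E); first by rewrite -EFinD lee_fin.
by rewrite leeD2r//; apply: ereal_sup_ubound; exists n => //; exact: NV.
Qed.

(** This makes multiplicative constants disappear from the exponents: a factor of logarithm [c]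
    shifts the base-[n] logarithm by [c / ln n], eventually at most [e]. *)
Lemma ln_ratio_small (R : realType) (c e : R) : 0 < e ->
  exists N, forall n, (N <= n)%N -> 0 < ln (n%:R : R) /\ c <= e * ln n%:R.
Proof.
move=> e0; set y := expR (Num.max 1 (c / e)).
exists (Num.truncn y).+1 => n Nn.
have yn : y < n%:R by apply: lt_le_trans (truncnS_gt y) _; rewrite ler_nat.
have n0 : (0 : R) < n%:R by apply: lt_trans yn; exact: expR_gt0.
have le_ln : Num.max 1 (c / e) <= ln n%:R.
  by rewrite -[leLHS]expRK ler_ln ?posrE ?expR_gt0// ltW.
move: le_ln; rewrite ge_max => /andP[l1]; rewrite ler_pdivrMr// mulrC => l2.
by split=> //; exact: lt_le_trans l1.
Qed.

Lemma ln_CpowR (R : realType) (c v : R) (n : nat) : 0 < c -> (0 < n)%N ->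
  ln (c * n%:R `^ v) = ln c + v * ln n%:R.
Proof.
by move=> c0 n0; rewrite lnM ?posrE ?powR_gt0 ?ltr0n// ln_powR.
Qed.

Lemma e_max_equilateral d n : exists2 S : {set hypercube n},
  equilateral d S & e_max d n = #|S|.
Proof.
have [|S eqS eS] := @eq_bigmax_cond _ (@equilateral n d) (fun S => #|S|).
  apply/card_gt0P; exists [set [ffun=> false]]; rewrite unfold_in.
  apply/equilateralP; split; first by rewrite -cards_eq0 cards1.
  by move=> x y; rewrite !inE => /eqP-> /eqP->; rewrite eqxx.
by exists S => //; exact: eS.
Qed.

Lemma e_max_gt0 d n : (0 < e_max d n)%N.
Proof.
have [S /equilateralP[S0 _] ->] := e_max_equilateral d n.
by rewrite card_gt0.
Qed.

Lemma e_max_le d n : (e_max d n <= 4 * d ^ 2 + 2)%N || (d * e_max d n <= 2 * n)%N.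
Proof.
by have [S eqS ->] := e_max_equilateral d n; exact: equilateral_card eqS.
Qed.

Lemma ler_powRl (R : realType) (r x y : R) :
  0 <= r -> 0 <= x -> x <= y -> x `^ r <= y `^ r.
Proof.
move=> r0 x0 xy; apply: ge0_ler_powR => //; rewrite nnegrE//.
exact: le_trans xy.
Qed.

Lemma exponent_le (R : realType) (a v c : R) : 0 < c ->
  (forall n, (0 < n)%N -> (e_max (Num.truncn (n%:R `^ a)) n)%:R <= c * n%:R `^ v) ->
  (equilateral_exponent a <= v%:E)%E.
Proof.
move=> c0 H; apply: limn_esup_le => e e0.
have [N HN] := ln_ratio_small (ln c) e0; exists (maxn 1 N) => n.
rewrite geq_max => /andP[n0 /HN[ln0 lnc]].
rewrite /logb ler_pdivrMr// mulrDl addrC.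
rewrite -(lerD2r (v * ln n%:R)) -ln_CpowR// in lnc.
apply: le_trans lnc; rewrite ler_ln ?posrE ?ltr0n ?e_max_gt0 ?H//.
by rewrite mulr_gt0 ?powR_gt0 ?ltr0n.
Qed.

Lemma exponent_ge (R : realType) (a v c : R) : 0 < c ->
  (forall N, exists2 n, (N <= n)%N &
     c * n%:R `^ v <= (e_max (Num.truncn (n%:R `^ a)) n)%:R) ->
  (v%:E <= equilateral_exponent a)%E.
Proof.
move=> c0 H; apply: le_limn_esup => e e0 N.
have [N' HN] := ln_ratio_small (- ln c) e0.
have [n] := H (maxn 1 (maxn N N')).
rewrite !geq_max => /and3P[n0 Nn /HN[ln0 lnc]] le_e; exists n => //.
rewrite -lerBlDr /logb ler_pdivlMr// mulrBl.
move: lnc; rewrite lerNl -(lerD2r (v * ln n%:R)) -ln_CpowR// addrC => lnc.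
apply: le_trans lnc _; rewrite ler_ln ?posrE ?ltr0n ?e_max_gt0 ?H//.
by rewrite mulr_gt0 ?powR_gt0 ?ltr0n.
Qed.

(** Since [1 <= n^a], rounding down loses at most a factor [2]. *)
Lemma truncn_powR_bounds (R : realType) (a : R) (n : nat) : 0 < a -> (0 < n)%N ->
  let t : R := n%:R `^ a in let d := Num.truncn t in
  [/\ (0 < d)%N, d%:R <= t & t <= 2 * d%:R].
Proof.
move=> a0 n0 t d.
have t1 : 1 <= t by rewrite -[leLHS](powRr0 (n%:R : R)) ler_powR ?ler1n// ltW.
have d0 : (0 < d)%N by rewrite truncn_gt0.
have dt : d%:R <= t by rewrite truncn_le// (le_trans _ t1).
split=> //; apply: (le_trans (ltW (truncnS_gt t))).
by rewrite -natrM ler_nat -/d; lia.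
Qed.

(** * Upper bound on the exponent *)

Lemma exponent_upper (R : realType) (a : R) : 0 < a -> a < 1 ->
  (equilateral_exponent a <= (Num.max (1 - a) (2 * a))%:E)%E.
Proof.
(* The constant [6] covers both cases: [4 d^2 + 2 <= 6 t^2] and [2 n / d <= 4 n / t], where
   [t = n^a]. *)
move=> a0 a1; apply: (@exponent_le _ _ _ 6) => // n n0.
have [] := truncn_powR_bounds a0 n0.
set t := n%:R `^ a; set d := Num.truncn t => d0 dt td.
have n1 : 1 <= n%:R :> R by rewrite ler1n.
have d1 : 1 <= d%:R :> R by rewrite ler1n.
have t0 : 0 < t by rewrite powR_gt0 ?ltr0n.
have pow w : w <= Num.max (1 - a) (2 * a) ->
    6 * n%:R `^ w <= 6 * n%:R `^ Num.max (1 - a) (2 * a).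
  by move=> ww; rewrite ler_pM2l// ler_powR.
case/orP: (e_max_le d n).
  rewrite -(ler_nat R) natrD natrM natrX => le_e; apply: (le_trans le_e).
  apply: le_trans (pow (2 * a) _); last by rewrite le_max lexx orbT.
  rewrite [2 * a]mulrC powRrM -/t (powR_mulrn 2 (ltW t0)).
  have dd : d%:R ^+ 2 <= t ^+ 2 by rewrite ler_sqr ?nnegrE ?ler0n// ltW.
  have dd1 : 1 <= d%:R ^+ 2 :> R by rewrite expr_ge1// (le_trans ler01).
  lra.
rewrite -(ler_nat R) !natrM => le_e.
apply: le_trans (pow (1 - a) _); last by rewrite le_max lexx.
rewrite powRB ?(gt_eqF (lt_le_trans ltr01 n1)) ?implybT// powRr1 ?ler0n// -/t.
rewrite mulrA ler_pdivlMr//.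
have e0 : 0 <= (e_max d n)%:R :> R by rewrite ler0n.
nra.
Qed.

(** * Lower bounds on the exponent *)

Lemma powR_succ (R : realType) (a : R) (m : nat) : 0 < a -> a < 1 ->
  (m.+1%:R : R) `^ a <= m%:R `^ a + 1.
Proof.
move=> a0 a1; have [->|m0] := posnP m.
  by rewrite powR1 powR0 ?gt_eqF// add0r.
have m1 : (1 : R) <= m%:R by rewrite ler1n.
have mp : (0 : R) < m%:R by rewrite ltr0n.
have -> : (m.+1%:R : R) = m%:R * (1 + m%:R^-1).
  by rewrite -natr1 mulrDr mulr1 divff// gt_eqF.
rewrite powRM ?ler0n ?addr_ge0// ?invr_ge0 ?ler0n//.
apply: (@le_trans _ _ (m%:R `^ a * (1 + m%:R^-1))).
  by rewrite ler_wpM2l ?powR_ge0// ler1_powR ?ltW// ltrDl invr_gt0.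
rewrite mulrDr mulr1 lerD2l ler_pdivrMr// mul1r.
by rewrite ler1_powR// ltW.
Qed.

(** The least [n] with [d <= n^a] works, because [n^a] grows by at most [1] per step. Hence any
    distance produced by the codes is realized in some dimension. *)
Lemma truncn_powR_surj (R : realType) (a : R) (d : nat) : 0 < a -> a < 1 -> (0 < d)%N ->
  exists2 n, (0 < n)%N & Num.truncn ((n%:R : R) `^ a) = d.
Proof.
move=> a0 a1 d0; have aN0 : a != 0 by rewrite gt_eqF.
have ex : exists n, (d%:R : R) <= n%:R `^ a.
  exists (Num.truncn ((d%:R : R) `^ a^-1)).+1.
  apply: (@le_trans _ _ ((d%:R `^ a^-1) `^ a)).
    by rewrite -powRrM mulVf// powRr1// ler0n.
  by apply: ler_powRl; rewrite ?powR_ge0//; [exact: ltW|exact/ltW/truncnS_gt].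
case: (ex_minnP ex) => -[|m] dm min_m.
  by move: dm; rewrite powR0 ?gt_eqF// lern0 => /eqP d00; rewrite d00 in d0.
exists m.+1 => //; apply: truncn_def; rewrite dm /=.
apply: le_lt_trans (powR_succ m a0 a1) _; rewrite -natr1 ltrD2r ltNge.
by apply/negP => /min_m; rewrite ltnn.
Qed.

(** Choose [n] with [d] the integer part of [n^a]. The first condition gives [p <= n^(1 - a)], so
    the code fits: [d p <= n]. The second makes [p^(2^k)] at least a constant times [n^v]. As
    [n >= p], large primes give large [n]. *)
Lemma exponent_lower (R : realType) (a v C : R) (k : nat) : 0 < a -> a < 1 ->
  0 <= v -> 0 < C ->
  (forall p, prime p -> exists2 r, (0 < r)%N &
     let d := (2 * r * p ^ (2 ^ k).-1)%N in
     p%:R <= d%:R `^ ((1 - a) / a) /\ d%:R `^ (v / a) <= C * p%:R ^+ (2 ^ k)) ->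
  (v%:E <= equilateral_exponent a)%E.
Proof.
move=> a0 a1 v0 C0 H.
(* The factor [2 ^ (v / a)] pays for replacing [n^a] by [2 d]. *)
have C'0 : 0 < (C * 2 `^ (v / a))^-1 by rewrite invr_gt0 mulr_gt0 ?powR_gt0.
apply: (exponent_ge C'0) => N.
have [p Np pp] := prime_above N; have [r r0] := H p pp.
set d := (2 * r * _)%N => -[pd dC].
have d0 : (0 < d)%N by rewrite /d !muln_gt0 r0 expn_gt0 (prime_gt0 pp).
have [n n0 nd] := truncn_powR_surj a0 a1 d0.
have [_] := truncn_powR_bounds a0 n0; rewrite nd.
have n1 : 1 <= n%:R :> R by rewrite ler1n.
have nN0 : (n%:R : R) != 0 by rewrite pnatr_eq0 -lt0n.
have aN0 : a != 0 by rewrite gt_eqF.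
set t := n%:R `^ a => dt td.
have powt w : t `^ (w / a) = n%:R `^ w.
  by rewrite /t -powRrM mulrCA divff// mulr1.
have pn : p%:R <= n%:R `^ (1 - a).
  rewrite -powt; apply: (le_trans pd).
  by apply: ler_powRl; rewrite ?divr_ge0 ?subr_ge0// ltW.
exists n.
  apply: ltnW; apply: leq_trans Np _; rewrite -(ler_nat R).
  by apply: (le_trans pn); rewrite ler1_powR// gerBl ltW.
rewrite nd; apply: (@le_trans _ _ (p ^ 2 ^ k)%:R); last first.
  rewrite ler_nat e_max_ge// -(ler_nat R) natrM.
  have -> : (n%:R : R) = n%:R `^ a * n%:R `^ (1 - a).
    by rewrite -powRD ?nN0 ?implybT// subrKC powRr1// ler0n.
  by apply: ler_pM => //; rewrite ler0n.
rewrite ler_pdivrMl ?mulr_gt0 ?powR_gt0// natrX -powt.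
apply: (@le_trans _ _ ((2 * d%:R) `^ (v / a))).
  by apply: ler_powRl; rewrite ?powR_ge0 ?divr_ge0// ltW.
by rewrite powRM ?ler0n// mulrAC mulrC ler_pM2r ?powR_gt0.
Qed.

(** The block size [r] is tuned to give [d] the order of [p^(a / (1 - a))], the least order that the
    condition on [p] allows. The hypothesis on [a] says that the ideal size [x] is at least [1]. *)
Lemma exponent_ge_repetition (R : realType) (a : R) (k : nat) : 0 < a -> a < 1 ->
  1 - 2 ^- k <= a -> (((1 - a) / 2 ^- k)%:E <= equilateral_exponent a)%E.
Proof.
move=> a0 a1 ka; rewrite invrK; set K : R := 2 ^+ k in ka *.
have K1 : 1 <= K by rewrite exprn_ege1// ler1n.
have K0 : 0 < K by rewrite exprn_gt0.
have b0 : 0 < 1 - a by rewrite subr_gt0.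
have aN0 : a != 0 by rewrite gt_eqF.
have bN0 : 1 - a != 0 by rewrite gt_eqF.
have v0 : 0 <= (1 - a) * K by rewrite mulr_ge0// ltW.
apply: (@exponent_lower _ _ _ (4 `^ ((1 - a) * K / a)) k) => //.
move=> p pp; have p1 : 1 <= p%:R :> R by rewrite ler1n prime_gt0.
have p0 : 0 < p%:R :> R by rewrite ltr0n prime_gt0.
have pN0 : (p%:R : R) != 0 by rewrite gt_eqF.
set b := a / (1 - a); set x : R := p%:R `^ (b - (K - 1)).
have x1 : 1 <= x.
  rewrite -[leLHS](powRr0 (p%:R : R)) ler_powR// subr_ge0 ler_pdivlMr//.
  move: ka; rewrite -(ler_pM2r K0) mulrBl mulVf ?gt_eqF//; lra.
exists (Num.truncn x).+1 => //=.
set d := (2 * _ * _)%N.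
have dE : d%:R = 2 * (Num.truncn x).+1%:R * p%:R `^ (K - 1) :> R.
  rewrite /d !natrM natrX -powR_mulrn ?ler0n//; congr (_ * _ `^ _).
  by rewrite -subn1 natrB ?expn_gt0// natrX.
(* From [x <= r <= 2 x] follow [p^b <= d <= 4 p^b], the source of the constant [4]. *)
have xp : x * p%:R `^ (K - 1) = p%:R `^ b by rewrite -powRD ?pN0 ?implybT// subrK.
have Kp0 : 0 < (p%:R : R) `^ (K - 1) by rewrite powR_gt0.
have bd : p%:R `^ b <= d%:R.
  rewrite -xp dE ler_pM2r//; have := truncnS_gt x; lra.
have db : d%:R <= 4 * p%:R `^ b.
  rewrite -xp dE mulrA ler_pM2r// -natr1.
  have : (Num.truncn x)%:R <= x by rewrite truncn_le (le_trans ler01).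
  lra.
split.
  apply: (@le_trans _ _ ((p%:R `^ b) `^ ((1 - a) / a))).
    by rewrite -powRrM mulrA divfK// divff// powRr1// ltW.
  by apply: ler_powRl; rewrite ?powR_ge0 ?divr_ge0// ltW.
apply: (@le_trans _ _ ((4 * p%:R `^ b) `^ ((1 - a) * K / a))).
  by apply: ler_powRl; rewrite ?ler0n ?divr_ge0// ltW.
rewrite powRM ?powR_ge0// -powRrM -[in leRHS]powR_mulrn ?ler0n// natrX -/K.
by rewrite (_ : b * _ = K)// /b; field; apply/andP.
Qed.

(** With [r = 1], [d = 2 p^(K - 1)] makes the size condition an equality. The other one follows from
    [p <= d^(1 / (K - 1))], as the bound on [a] means [1 / (K - 1) <= (1 - a) / a]. *)
Lemma exponent_ge_tower (R : realType) (a : R) (k : nat) : 0 < a -> (0 < k)%N ->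
  a <= 1 - 2 ^- k -> ((a / (1 - 2 ^- k))%:E <= equilateral_exponent a)%E.
Proof.
move=> a0 k0 ka; set K : R := 2 ^+ k in ka *.
have K2 : 2 <= K by rewrite -[leLHS]expr1 ler_eXn2l ?ltr1n.
have K0 : 0 < K by lra.
have KN0 : K != 0 by rewrite gt_eqF.
have K10 : 0 < K - 1 by lra.
have K1N0 : K - 1 != 0 by rewrite gt_eqF.
have a1 : a < 1 by apply: (le_lt_trans ka); rewrite ltrBlDr ltrDl invr_gt0.
have aN0 : a != 0 by rewrite gt_eqF.
have vE : a / (1 - K^-1) / a = K / (K - 1) by field; rewrite ?aN0 ?K1N0 ?KN0.
apply: (@exponent_lower _ _ _ (2 `^ (K / (K - 1))) k) => //.
  by apply: divr_ge0; [exact: ltW|rewrite subr_ge0 invf_le1//; lra].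
move=> p pp; exists 1%N => //=; rewrite muln1 vE.
have p1 : 1 <= p%:R :> R by rewrite ler1n prime_gt0.
have dE : (2 * p ^ (2 ^ k).-1)%:R = 2 * p%:R `^ (K - 1) :> R.
  rewrite natrM natrX -powR_mulrn ?ler0n//; congr (_ * _ `^ _).
  by rewrite -subn1 natrB ?expn_gt0// natrX.
have pK1 : 1 <= (p%:R : R) `^ (K - 1).
  by rewrite -[leLHS](powRr0 (p%:R : R)) ler_powR// ltW.
rewrite dE; split.
  apply: (@le_trans _ _ ((2 * p%:R `^ (K - 1)) `^ (K - 1)^-1)).
    apply: (@le_trans _ _ ((p%:R `^ (K - 1)) `^ (K - 1)^-1)).
      by rewrite -powRrM divff// powRr1// ler0n.
    apply: ler_powRl; rewrite ?powR_ge0 ?invr_ge0//; lra.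
  apply: ler_powR; first lra.
  rewrite -div1r ler_pdivrMr// mulrAC ler_pdivlMr// mul1r.
  move: ka; rewrite -(ler_pM2r K0) mulrBl mulVf// mul1r; lra.
rewrite powRM ?powR_ge0// -powRrM mulrCA divff// mulr1.
by rewrite -[in leRHS]powR_mulrn ?ler0n// natrX.
Qed.

Lemma exponent_ge_max (R : realType) (k : nat) (a : R) : 0 < a -> a < 1 ->
  1 - 2 ^- k <= a -> a <= 1 - 2 ^- (k + 1) ->
  ((Num.max ((1 - a) / 2 ^- k) (a / (1 - 2 ^- (k + 1))))%:E
     <= equilateral_exponent a)%E.
Proof.
move=> a0 a1 ka ak; rewrite EFin_max ge_max exponent_ge_repetition//=.
by rewrite exponent_ge_tower// addn1.
Qed.

(** * Minimal value, and exact value for [a <= 1 / 2] *)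

Lemma dyadic_bracket (R : realType) (a : R) : 0 < a -> a < 1 ->
  exists k : nat, 1 - 2 ^- k <= a /\ a <= 1 - 2 ^- (k + 1).
Proof.
move=> a0 a1; have b0 : 0 < 1 - a by rewrite subr_gt0.
have ex : exists m : nat, a <= 1 - 2 ^- m.
  exists (Num.truncn (1 - a)^-1).+1; rewrite lerBrDl -lerBrDr.
  rewrite invf_ple ?posrE ?exprn_gt0//.
  apply: ltW; apply: (lt_le_trans (truncnS_gt _)).
  by rewrite -natrX ler_nat ltnW// ltn_expl.
(* The least such exponent is not [0], since [0 < a]; its predecessor is the required [k]. *)
case: (ex_minnP ex) => -[|k] ka min_k.
  by move: ka; rewrite expr0 invr1 subrr leNgt a0.
exists k; rewrite addn1; split=> //; rewrite leNgt; apply/negP => /ltW/min_k.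
by rewrite ltnn.
Qed.

Lemma two_thirds_le_exponent (R : realType) (a : R) : 0 < a -> a < 1 ->
  ((2 / 3)%:E <= equilateral_exponent a)%E.
Proof.
move=> a0 a1; have [k [ka ak]] := dyadic_bracket a0 a1.
apply: le_trans (exponent_ge_max a0 a1 ka ak).
rewrite lee_fin le_max invrK addn1; set K : R := 2 ^+ k.
have K1 : 1 <= K by rewrite exprn_ege1// ler1n.
(* If the first bound fails, then [2 K a > 2 K - 4 / 3], which is at least [(2 / 3) (2 K - 1)]
   because [1 <= K]. *)
have [//|lt] := leP (2 / 3) ((1 - a) * K); rewrite /= exprS -/K.
have K0 : 2 * K != 0 by lra.
rewrite ler_pdivlMr; last by rewrite subr_gt0 invf_lt1; lra.
rewrite -(ler_pM2r (_ : 0 < 2 * K)); last lra.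
rewrite mulrBr mulr1 mulrBl mulfVK//; lra.
Qed.

Lemma exponent_half (R : realType) (a : R) : 0 < a -> a <= 1 / 2 ->
  equilateral_exponent a = (Num.max (1 - a) (2 * a))%:E.
Proof.
move=> a0 a2; have a1 : a < 1 by lra.
apply/le_anti/andP; split; first exact: exponent_upper.
(* At level [k = 0] the lower bound coincides with the upper one. *)
have := @exponent_ge_max R 0 a a0 a1.
rewrite add0n expr0 expr1 invr1 divr1 (_ : a / (1 - 2^-1) = 2 * a); last by field.
by apply; lra.
Qed.

Theorem theorem5p3 (R : realType) :
  [/\ (forall a : R, 0 < a -> a <= 1 / 2 ->
         equilateral_exponent a = (Num.max (1 - a) (2 * a))%:E),
      (forall (k : nat) (a : R), (1 <= k)%N ->
         1 - 2 ^- k <= a -> a <= 1 - 2 ^- (k + 1) ->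
         ((Num.max ((1 - a) / 2 ^- k) (a / (1 - 2 ^- (k + 1))))%:E
            <= equilateral_exponent a)%E)
    & ((exists a : R, [/\ 0 < a, a < 1 & equilateral_exponent a = (2 / 3)%:E]) /\
       (forall a : R, 0 < a -> a < 1 -> ((2 / 3)%:E <= equilateral_exponent a)%E))].
Proof.
split; first exact: exponent_half.
- move=> k a k1 ka ak.
  have pow2V m : 0 < (2 : R) ^- m by rewrite invr_gt0 exprn_gt0.
  apply: exponent_ge_max => //.
    apply: lt_le_trans ka; rewrite subr_gt0 invf_lt1 ?exprn_gt0//.
    by rewrite exprn_egt1 ?ltr1n// -lt0n.
  by apply: (le_lt_trans ak); rewrite ltrBlDr ltrDl.
- split; last exact: two_thirds_le_exponent.
  (* The point [1 / 3] is where [1 - a = 2 a]. *)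
  exists (1 / 3); split; [lra|lra|].
  rewrite exponent_half; [|lra|lra].
  have e1 : 1 - 1 / 3 = 2 / 3 :> R by field.
  have e2 : 2 * (1 / 3) = 2 / 3 :> R by field.
  by rewrite e1 e2 maxxx.
Qed.
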